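(* Let $m\in\mathbb N$, $n\in\mathbb N^m$, and let $M\in\mathbb N_0^n$ be a principal reversible cuboid. Then there exist $L\in\mathbb N_0$ and numbers $j_l\in\{1,\dots,m\}$, $f_l\in\mathbb N+1$ ($l\in\{1,\dots,L\}$) such that $\prod_{l:\,j_l=j}f_l=n_j$ for every $j\in\{1,\dots,m\}$ and \[M={\cal B}_{j_L,f_L}\circ{\cal B}_{j_{L-1},f_{L-1}}\circ\dots\circ{\cal B}_{j_1,f_1}((0)),\] where $(0)\in\mathbb N_0^{1_m}$ is the trivial cuboid with single entry $0$. Moreover, these may be chosen such that $j_l\ne j_{l-1}$ for all $l\in\{2,\dots,L\}$.
   Context: $\mathbb N=\{1,2,\dots\}$, $\mathbb N_0=\mathbb N\cup\{0\}$, $\mathbb N+1=\{2,3,\dots\}$, $\langle N\rangle=\{0,\dots,N-1\}$. For $n\in\mathbb N^m$, a cuboid (tensor) $M\in\mathbb N_0^n$ is a family of entries $M_k\in\mathbb N_0$ indexed by $k\in\mathbb N^m$, $k\le n$ componentwise; $1_m=(1,\dots,1)$, $e_j$ the $j$-th unit vector. Property (V): for all $1\le i<j\le m$ and all index vectors in range, $M_{k_1,\dots,k_i,\dots,k_j,\dots,k_m}+M_{k_1,\dots,k_i',\dots,k_j',\dots,k_m}=M_{k_1,\dots,k_i,\dots,k_j',\dots,k_m}+M_{k_1,\dots,k_i',\dots,k_j,\dots,k_m}$ (vacuous if $m=1$). $M$ is a principal reversible cuboid if it has (V), its set of entries is $\langle\prod_j n_j\rangle$, and $M_k<M_{k+le_j}$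 whenever $1\le l\le n_j-k_j$ (dimensions $n_j=1$ allowed). Direction-$j$ Kronecker product: for $v\in\mathbb N_0^k$ and $M\in\mathbb N_0^n$, $v\otimes_jM\in\mathbb N_0^{n+(k-1)n_je_j}$ is defined by $(v\otimes_jM)_{\hat n+ln_je_j}=v_{l+1}M_{\hat n}$ ($\hat n\le n$, $l\in\langle k\rangle$). Let $\overrightarrow{\langle k\rangle}=(0,1,\dots,k-1)$, $1_k$ the all-ones vector of length $k$, $1_{[n]}$ the all-ones cuboid of dimension $n$. The building operator is ${\cal B}_{j,k}(M)=\bigl(\prod_{r=1}^m n_r\bigr)\overrightarrow{\langle k\rangle}\otimes_j1_{[n]}+1_k\otimes_jM\in\mathbb N_0^{n+(k-1)n_je_j}$ for $M\in\mathbb N_0^n$. An empty composition ($L=0$) is the identity. *)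

(* Defs.v *)
From mathcomp Require Import all_boot.
Set Implicit Arguments. Unset Strict Implicit. Unset Printing Implicit Defensive.

Definition dims (m : nat) := {ffun 'I_m -> nat}.

(* Indices are 0-based: the coordinate k_j in {1, ..., n_j} is represented by
   the ordinal k_j - 1 in 'I_(n j). *)
Definition cindex (m : nat) (n : dims m) := {dffun forall j : 'I_m, 'I_(n j)}.

Definition cuboid (m : nat) (n : dims m) := {ffun cindex n -> nat}.

Definition set_coord (m : nat) (n : dims m) (k : cindex n) (j : 'I_m)
    (a : 'I_(n j)) : cindex n :=
  finfun (dfwith k a).

Definition propertyV (m : nat) (n : dims m) (M : cuboid n) : Prop :=
  forall (i j : 'I_m), i < j ->
  forall (k : cindex n) (a : 'I_(n i)) (b : 'I_(n j)),
    M k + M (set_coord (set_coord k a) b) =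
    M (set_coord k b) + M (set_coord k a).

(* In the last clause a plays the role of k_j + l with 1 <= l <= n_j - k_j. *)
Definition principal_reversible (m : nat) (n : dims m) (M : cuboid n) : Prop :=
  [/\ propertyV M,
      forall x : nat, (exists k : cindex n, M k = x) <-> x < \prod_j n j &
      forall (k : cindex n) (j : 'I_m) (a : 'I_(n j)),
        k j < a -> M k < M (set_coord k a)].

(* n + (k - 1) n_j e_j, for k >= 1 *)
Definition kron_dims (m : nat) (n : dims m) (j : 'I_m) (k : nat) : dims m :=
  [ffun i => if i == j then k * n j else n i].

Lemma kron_dims_modn (m : nat) (n : dims m) (j : 'I_m) (k : nat)
    (p : cindex (kron_dims n j k)) (i : 'I_m) : p i %% n i < n i.
Proof.
rewrite ltn_mod; have: 0 < kron_dims n j k i by exact: leq_ltn_trans (ltn_ord (p i)).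
rewrite ffunE; case: eqP => [->|_] //.
by case: (n j) => //; rewrite muln0.
Qed.

(* An index p of v \otimes_j M is uniquely q + l n_j e_j with q an index of M
   and l < k: q_i = p_i %% n_i (which is p_i for i != j) and l = p_j %/ n_j;
   see kronE. *)
Definition kron_index (m : nat) (n : dims m) (j : 'I_m) (k : nat)
    (p : cindex (kron_dims n j k)) : cindex n :=
  [ffun i : 'I_m => Ordinal (kron_dims_modn p i)].

Definition kron (m : nat) (n : dims m) (j : 'I_m) (k : nat)
    (v : k.-tuple nat) (M : cuboid n) : cuboid (kron_dims n j k) :=
  [ffun p : cindex (kron_dims n j k) =>
     nth 0 v (p j %/ n j) * M (kron_index p)].

Lemma kronE (m : nat) (n : dims m) (j : 'I_m) (k : nat) (v : k.-tuple nat)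
    (M : cuboid n) (q : cindex n) (l : 'I_k) (p : cindex (kron_dims n j k)) :
  (forall i, p i = q i + (if i == j then l * n j else 0) :> nat) ->
  kron j v M p = tnth v l * M q.
Proof.
move=> pE; rewrite ffunE; congr (_ * M _).
  rewrite (tnth_nth 0); congr nth; have lt_q := ltn_ord (q j).
  rewrite pE eqxx addnC divnMDl ?divn_small ?addn0 //.
  exact: leq_ltn_trans lt_q.
apply/ffunP => i; apply/val_inj; rewrite ffunE /= pE.
case: eqP => [->|_]; last by rewrite addn0 modn_small.
by rewrite addnC modnMDl modn_small.
Qed.

Definition building (m : nat) (n : dims m) (j : 'I_m) (k : nat)
    (M : cuboid n) : cuboid (kron_dims n j k) :=
  [ffun p => (\prod_r n r) * kron j (iota_tuple k 0) [ffun _ : cindex n => 1] p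
             + kron j (nseq_tuple k 1) M p].

(* Building changes the dimensions, so compositions of building operators are
   formed on cuboids packed with their dimension vector. *)
Definition packed_cuboid (m : nat) := {n : dims m & cuboid n}.

Definition pack (m : nat) (n : dims m) (M : cuboid n) : packed_cuboid m :=
  existT (@cuboid m) n M.

Definition packed_building (m : nat) (C : packed_cuboid m) (jk : 'I_m * nat) :
    packed_cuboid m :=
  pack (building jk.1 jk.2 (tagged C)).

(* B_{j_L, f_L} o ... o B_{j_1, f_1} *)
Definition building_comp (m L : nat) (j : 'I_L -> 'I_m) (f : 'I_L -> nat)
    (C : packed_cuboid m) : packed_cuboid m :=
  foldl (@packed_building m) C [seq (j l, f l) | l <- enum 'I_L].

Definition trivial_cuboid (m : nat) : cuboid ([ffun _ => 1] : dims m) :=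
  [ffun _ => 0].

(* Main.v *)
Require Import Defs.
From mathcomp Require Import all_boot zify.
Set Implicit Arguments.
Unset Strict Implicit.
Unset Printing Implicit Defensive.

(** Property (V) makes the entries of [M] sums of the values on the axes, so
    the sets [A_i] of axis values sum directly to an initial segment.  If [1]
    lies in [A_j] and [f] is the first number missing from [A_j], then, as in
    de Bruijn's theorem on additive number systems, [A_j] is a union of blocks
    [[q f, q f + f)] and all other [A_i] consist of multiples of [f].  Dividing
    by [f] yields a smaller system; this removes the innermost building
    operator, in direction [j] with factor [f].  After the division [1] no
    longer belongs to [A_j], so consecutive directions differ. *)

Record initial_direct_sum (A B : nat -> Prop) : Prop := InitialDirectSum {
  direct_sum_0l : A 0;
  direct_sum_0r : B 0;
  direct_sum_inj : forall a b a' b',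
    A a -> B b -> A a' -> B b' -> a + b = a' + b' -> a = a';
  direct_sum_down : forall a b x, A a -> B b -> x <= a + b ->
    exists a' b', [/\ A a', B b' & x = a' + b'] }.

Definition first_gap (A : nat -> Prop) f : Prop :=
  (forall r, r < f -> A r) /\ ~ A f.

Section FirstGap.

Variables (A B : nat -> Prop) (f : nat).
Hypothesis AB_sum : initial_direct_sum A B.
Hypothesis A_gap : first_gap A f.

Let A0 : A 0 := direct_sum_0l AB_sum.
Let B0 : B 0 := direct_sum_0r AB_sum.
Let A_run : forall r, r < f -> A r := A_gap.1.

Lemma first_gap_gt0 : 0 < f.
Proof. by have [f0|//] := posnP f; case: A_gap.2; rewrite f0. Qed.

Lemma summand_lt_gap b : B b -> b < f -> b = 0.
Proof.
by move=> Bb /A_run Ab; have := direct_sum_inj AB_sum A0 Bb Ab B0; lia.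
Qed.

Lemma gap_in_summand a b : A a -> B b -> f <= a + b -> B f.
Proof.
move=> Aa Bb /(direct_sum_down AB_sum Aa Bb) [a' [b' [Aa' Bb' fE]]].
have [ltb'|geb'] := ltnP b' f; last by have -> : f = b' by lia.
by case: A_gap.2; rewrite fE (summand_lt_gap Bb') // addn0.
Qed.

Definition block_aligned x : Prop :=
  (A x -> forall r, r < f -> A (x %/ f * f + r)) /\ (B x -> f %| x).

Section BlockStep.

Variable q : nat.
Hypothesis q_gt0 : 0 < q.
Hypothesis aligned_below : forall x, x < q * f -> block_aligned x.

Let f_gt0 : 0 < f := first_gap_gt0.
Let le_fqf : f <= q * f. Proof. exact: leq_pmull. Qed.

Definition shifted_run c d : Prop :=
  [/\ 0 < d, B d, q * f = c + d & forall r, r < f -> A (c + r)].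

Lemma block_start_cases x : A x \/ B x -> q * f <= x ->
  A (q * f) \/ exists c d, shifted_run c d.
Proof.
move=> ABx le_x.
have [c [d [Ac Bd qfE]]] : exists c d, [/\ A c, B d & q * f = c + d].
  case: ABx => [Ax|Bx]; first by apply: (direct_sum_down AB_sum Ax B0); lia.
  by apply: (direct_sum_down AB_sum A0 Bx); lia.
have [d0|d_gt0] := posnP d; first by left; rewrite qfE d0 addn0.
right; exists c, d; split=> // r ltr.
have dvd : f %| d.
  have [ltd|ged] := ltnP d (q * f); first exact: (aligned_below ltd).2.
  by have -> : d = q * f; [lia | exact: dvdn_mull].
have dvc : f %| c by rewrite -(dvdn_addl _ dvd) -qfE dvdn_mull.
have ltc : c < q * f by lia.
by have := (aligned_below ltc).1 Ac r ltr; rewrite divnK.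
Qed.

Lemma shifted_run_notin c d r : shifted_run c d -> r < f -> ~ A (q * f + r).
Proof.
move=> [d_gt0 Bd qfE run] ltr Ar.
by have := direct_sum_inj AB_sum (run _ ltr) Bd Ar B0; lia.
Qed.

Lemma shifted_run_summand c d r :
  shifted_run c d -> r < f -> B (q * f + r) -> r = 0.
Proof.
move=> [d_gt0 Bd qfE run] ltr Br.
by have := direct_sum_inj AB_sum (run _ ltr) Bd A0 Br; lia.
Qed.

Lemma full_block_summand r : A (q * f) -> r < f -> B (q * f + r) -> r = 0.
Proof.
move=> Aq ltr Br; have [//|r_gt0] := posnP r.
have Bf : B f by apply: (gap_in_summand Aq B0); lia.
have ltfr : f - r < f by lia.
by have := direct_sum_inj AB_sum (A_run ltfr) Br Aq Bf; lia.
Qed.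

Lemma full_block r : A (q * f) -> r < f -> A (q * f + r).
Proof.
move=> Aq ltr; have Bf : B f by apply: (gap_in_summand Aq B0); lia.
have [|a [b [Aa Bb qfrE]]] := direct_sum_down AB_sum (x := q * f + r) Aq Bf.
  lia.
have [b0|b_gt0] := posnP b; first by rewrite qfrE b0 addn0.
have [leb dvb] : b <= q * f /\ f %| b.
  have [ltb|geb] := ltnP b (q * f).
    by split; [exact: ltnW | exact: (aligned_below ltb).2].
  have ltr' : b - q * f < f by lia.
  have := full_block_summand Aq ltr'; rewrite subnKC // => /(_ Bb) b0.
  by have -> : b = q * f; [lia | split; [|exact: dvdn_mull]].
have le_fb : f <= b by exact: dvdn_leq.
have aE : a = (q - b %/ f) * f + r by rewrite mulnBl divnK //; lia.
have lta : a < q * f by lia.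
have := (aligned_below lta).1 Aa 0 f_gt0.
rewrite aE divnMDl // (divn_small ltr) !addn0 mulnBl divnK // => Aqb.
by have := direct_sum_inj AB_sum Aqb Bb Aq B0; lia.
Qed.

Lemma block_step r : r < f -> block_aligned (q * f + r).
Proof.
move=> ltr; rewrite /block_aligned divnMDl // divn_small // addn0.
have le_x : q * f <= q * f + r by exact: leq_addr.
split=> [Ar r' ltr'|Br].
  case: (block_start_cases (or_introl Ar) le_x) => [Aq|[c [d cd]]].
    exact: full_block.
  by case: (shifted_run_notin cd ltr).
suff -> : r = 0 by rewrite addn0 dvdn_mull.
case: (block_start_cases (or_intror Br) le_x) => [Aq|[c [d cd]]].
  exact: full_block_summand Br.
exact: shifted_run_summand cd ltr Br.
Qed.

End BlockStep.

Lemma first_gap_aligned x : block_aligned x.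
Proof.
have f_gt0 := first_gap_gt0.
suff below q y : y < q * f -> block_aligned y.
  by apply: (below (x %/ f).+1); exact: ltn_ceil.
elim: q y => // q IH y lty; have [|ge_y] := ltnP y (q * f); first exact: IH.
have yE : y = q * f + (y - q * f) by lia.
have lt_yq : y - q * f < f by lia.
have [q0|q_gt0] := posnP q; last by rewrite yE; exact: block_step.
have ltyf : y < f by lia.
split=> [_ r ltr|By]; first by rewrite divn_small // mul0n; exact: A_run.
by rewrite (summand_lt_gap By).
Qed.

End FirstGap.

Lemma mem_mkseqP (T : eqType) (g : nat -> T) n x :
  reflect (exists2 t, t < n & g t = x) (x \in mkseq g n).
Proof.
apply: (iffP mapP) => [[t]|[t ltt <-]].
  by rewrite mem_iota => ltt ->; exists t.
by exists t; rewrite // mem_iota.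
Qed.

Section IncreasingEnumeration.

Variables (g : nat -> nat) (n f : nat).
Hypothesis g_mono : {in gtn n &, {homo g : a b / a < b}}.
Hypothesis f_gt0 : 0 < f.
Hypothesis g_blocks : forall x r,
  x \in mkseq g n -> r < f -> x %/ f * f + r \in mkseq g n.

Let leq_g : {in gtn n &, {mono g : a b / a <= b}} := leq_mono_in g_mono.
Let ltn_g : {in gtn n &, {mono g : a b / a < b}} := leqW_mono_in leq_g.

Lemma enum_block_mem t r : t < n -> r < f ->
  exists2 t', t' < n & g t' = g t %/ f * f + r.
Proof.
move=> ltt ltr; apply/mem_mkseqP/g_blocks => //.
by apply/mem_mkseqP; exists t.
Qed.

Lemma enum_succ t : t < n -> ~~ (f %| (g t).+1) ->
  t.+1 < n /\ g t.+1 = (g t).+1.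
Proof.
move=> ltt ndvd; have ltr : (g t %% f).+1 < f.
  rewrite ltn_neqAle ltn_mod f_gt0 andbT; apply: contraNneq ndvd => rE.
  by rewrite [g t](divn_eq _ f) -addnS rE -mulSnr dvdn_mull.
have [t' ltt'] := enum_block_mem ltt ltr; rewrite addnS -divn_eq => gt'.
have lt_t : t < t' by rewrite -ltn_g ?gt'.
have ltn1 : t.+1 < n by exact: leq_ltn_trans ltt'.
split=> //; apply/eqP; rewrite eqn_leq -{1}gt' leq_g // lt_t /=.
by rewrite ltn_g.
Qed.

Lemma enum_modn t : t < n -> g t = t %[mod f].
Proof.
elim: t => [|t IH] ltt;
  have [t' ltt'] := enum_block_mem ltt f_gt0; rewrite addn0 => gt'.
  have t'0 : t' = 0 by apply/eqP; rewrite -leqn0 -leq_g // gt' leq_divM.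
  by rewrite -[in LHS]t'0 gt' modnMl mod0n.
have ltt_n := ltnW ltt.
have [dv|/(enum_succ ltt_n) [_ ->]] := boolP (f %| (g t).+1).
  have t'E : t' = t.+1.
    apply/eqP; rewrite eqn_leq -leq_g // gt' leq_divM -ltn_g // gt' -(divnK dv).
    by rewrite leq_mul2r leq_div2r ?orbT // ltn_g.
  have dvt : f %| t.+1 by rewrite /dvdn -addn1 -modnDml -IH // modnDml addn1.
  by rewrite -[in LHS]t'E gt' modnMl (eqP dvt).
by rewrite -(addn1 (g t)) -(addn1 t) -modnDml IH // modnDml.
Qed.

Lemma enum_block q r : q * f < n -> r < f ->
  q * f + r < n /\ g (q * f + r) = g (q * f) + r.
Proof.
move=> ltq; elim: r => [|r IH] ltr; first by rewrite !addn0.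
have [lt_n gE] := IH (ltnW ltr); rewrite !addnS -gE; apply: enum_succ => //.
rewrite /dvdn -addn1 -modnDml enum_modn // modnDml addn1 -addnS modnMDl.
by rewrite modn_small.
Qed.

Lemma enum_dvd_size : f %| n.
Proof.
have nE := divn_eq n f; have := ltn_pmod n f_gt0.
have [/eqP //|r_gt0] := posnP (n %% f).
have [||+ _] := @enum_block (n %/ f) f.-1; lia.
Qed.

End IncreasingEnumeration.

Section SumSystem.

Variable I : finType.
Implicit Types (n p : {ffun I -> nat}) (g : I -> nat -> nat) (i j : I).
Implicit Types s : seq (I * nat).

Definition update p j x : {ffun I -> nat} :=
  [ffun i => if i == j then x else p i].

Definition in_range n p := forall i, p i < n i.

Definition system_sum g p := \sum_i g i (p i).

Definition axis n g j : seq nat := mkseq (g j) (n j).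

Definition zero_index : {ffun I -> nat} := [ffun _ => 0].

Lemma update_same p j x : update p j x j = x.
Proof. by rewrite ffunE eqxx. Qed.

Lemma update_id p j : update p j (p j) = p.
Proof. by apply/ffunP => i; rewrite ffunE; case: eqP => // ->. Qed.

Lemma update_update p j x y : update (update p j x) j y = update p j y.
Proof. by apply/ffunP => i; rewrite !ffunE; case: eqP. Qed.

Lemma in_range_update n p j x :
  in_range n p -> x < n j -> in_range n (update p j x).
Proof. by move=> rp ltx i; rewrite ffunE; case: eqP => [->|]. Qed.

Lemma system_sumD1 g p j :
  system_sum g p = g j (p j) + \sum_(i | i != j) g i (p i).
Proof. by rewrite /system_sum (bigD1 j). Qed.

Lemma system_sum_update g p j x :
  system_sum g (update p j x) = g j x + \sum_(i | i != j) g i (p i).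
Proof.
rewrite (system_sumD1 _ _ j) update_same; congr (_ + _).
by apply: eq_bigr => i /negPf ij; rewrite ffunE ij.
Qed.

(* The sets [axis n g i] sum directly to an initial segment. *)
Record sum_system n g : Prop := SumSystem {
  system_gt0 : forall i, 0 < n i;
  system_axis0 : forall i, g i 0 = 0;
  system_mono : forall i, {in gtn (n i) &, {homo g i : a b / a < b}};
  system_inj : forall p p', in_range n p -> in_range n p' ->
    system_sum g p = system_sum g p' -> p = p';
  system_down : forall p x, in_range n p -> x <= system_sum g p ->
    exists2 p', in_range n p' & system_sum g p' = x }.

Section SystemTheory.

Variables (n : {ffun I -> nat}) (g : I -> nat -> nat).
Hypothesis sys : sum_system n g.

Lemma in_range_zero : in_range n zero_index.
Proof. by move=> i; rewrite ffunE (system_gt0 sys). Qed.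

Lemma system_sum_zero : system_sum g zero_index = 0.
Proof. by apply: big1 => i _; rewrite ffunE (system_axis0 sys). Qed.

Lemma system_sum_axis j x : system_sum g (update zero_index j x) = g j x.
Proof.
rewrite system_sum_update big1 ?addn0 // => i _.
by rewrite ffunE (system_axis0 sys).
Qed.

Lemma exists_one_in_axis i : 1 < n i -> exists j, 1 \in axis n g j.
Proof.
move=> ni_gt1.
have ge1 : 1 <= system_sum g (update zero_index i 1).
  rewrite system_sum_axis; apply: leq_ltn_trans (leq0n _) _.
  exact: (system_mono sys (ltnW ni_gt1) ni_gt1 (ltnSn 0)).
have [p rp p1] := system_down sys (in_range_update in_range_zero ni_gt1) ge1.
have [j gj] : exists j, g j (p j) != 0.
  apply/existsP; rewrite -negb_forall; apply/negP => /forallP g0.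
  by move: p1; rewrite /system_sum big1 // => j _; exact/eqP.
exists j; apply/mem_mkseqP; exists (p j) => //.
by have := system_sumD1 g p j; lia.
Qed.

Lemma exists_first_gap j : 1 \in axis n g j ->
  exists2 f, 1 < f & first_gap (fun x => x \in axis n g j) f.
Proof.
move=> axis1; pose missing x := x \notin axis n g j.
have missing_ex : exists x, missing x.
  exists (\max_(y <- axis n g j) y).+1; apply/negP.
  by move/(leq_bigmax_seq (P := xpredT) (F := id))/(_ isT); rewrite ltnn.
case: (ex_minnP missing_ex) => f gap f_min; exists f; last first.
  split=> [r ltr|]; last exact/negP.
  by apply/negPn/negP => /f_min; rewrite leqNgt ltr.
case: f gap {f_min} => [|[|//]]; rewrite /missing ?axis1 // => /mem_mkseqP[].
by exists 0; rewrite ?(system_gt0 sys) ?(system_axis0 sys).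
Qed.

Definition off_axis_sum j x :=
  exists2 p, in_range n p /\ p j = 0 & system_sum g p = x.

Lemma axis_direct_sum j :
  initial_direct_sum (fun x => x \in axis n g j) (off_axis_sum j).
Proof.
have sumE p t : p j = 0 -> system_sum g (update p j t) = g j t + system_sum g p.
  move=> p0; rewrite system_sum_update (system_sumD1 g p j).
  by rewrite p0 (system_axis0 sys).
split.
- by apply/mem_mkseqP; exists 0; rewrite ?(system_gt0 sys) ?(system_axis0 sys).
- exists zero_index; last exact: system_sum_zero.
  by split; [exact: in_range_zero | rewrite ffunE].
- move=> a b a' b' /mem_mkseqP[t ltt <-] [p [rp p0] <-].
  move=> /mem_mkseqP[t' ltt' <-] [p' [rp' p'0] <-]; rewrite -!sumE //.
  move=> /(system_inj sys (in_range_update rp ltt) (in_range_update rp' ltt')).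
  by move=> /ffunP/(_ j); rewrite !update_same => ->.
- move=> a b x /mem_mkseqP[t ltt <-] [p [rp p0] <-]; rewrite -sumE // => lex.
  have [p' rp' <-] := system_down sys (in_range_update rp ltt) lex.
  exists (g j (p' j)), (system_sum g (update p' j 0)); split.
  + by apply/mem_mkseqP; exists (p' j).
  + exists (update p' j 0) => //; rewrite update_same; split=> //.
    exact: in_range_update (system_gt0 sys j).
  + by rewrite -sumE ?update_same // update_update update_id.
Qed.

Section Peel.

Variables (j : I) (f : nat).
Hypothesis gap : first_gap (fun x => x \in axis n g j) f.

Let f_gt0 : 0 < f.
Proof. exact: first_gap_gt0 (axis_direct_sum j) gap. Qed.

Let aligned := first_gap_aligned (axis_direct_sum j) gap.

Let axis_blocks x r :
  x \in axis n g j -> r < f -> x %/ f * f + r \in axis n g j.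
Proof. by move=> jx; exact: (aligned x).1. Qed.

Lemma dvdn_other_axis i a : i != j -> a < n i -> f %| g i a.
Proof.
move=> ij lta; apply: (aligned _).2; exists (update zero_index i a).
  split; first exact: in_range_update in_range_zero lta.
  by rewrite ffunE eq_sym (negPf ij) ffunE.
exact: system_sum_axis.
Qed.

Lemma dvdn_block_start q : q * f < n j -> f %| g j (q * f).
Proof.
move=> ltq; rewrite /dvdn (enum_modn (@system_mono _ _ sys j) f_gt0) //.
by rewrite modnMl.
Qed.

Lemma axis_block q r :
  q * f < n j -> r < f -> g j (q * f + r) = g j (q * f) + r.
Proof.
move=> ltq ltr.
by have [] := enum_block (@system_mono _ _ sys j) f_gt0 axis_blocks ltq ltr.
Qed.

Lemma dvdn_axis_size : f %| n j.
Proof. exact: enum_dvd_size (@system_mono _ _ sys j) f_gt0 axis_blocks. Qed.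

Definition scale i a := if i == j then a * f else a.

Definition scale_index p : {ffun I -> nat} := [ffun i => scale i (p i)].

Definition peel_dims : {ffun I -> nat} := update n j (n j %/ f).

Definition peel_axes i a := g i (scale i a) %/ f.

Definition peel_index p : {ffun I -> nat} := update p j (p j %/ f).

Lemma ltn_scale i a : a < peel_dims i -> scale i a < n i.
Proof.
rewrite /scale ffunE; case: eqP => // ->.
by rewrite ltn_divRL // dvdn_axis_size.
Qed.

Lemma dvdn_scaled_axis i a : a < peel_dims i -> f %| g i (scale i a).
Proof.
move/ltn_scale; rewrite /scale; case: eqP => [->|/eqP].
  exact: dvdn_block_start.
exact: dvdn_other_axis.
Qed.

Lemma in_range_scale p : in_range peel_dims p -> in_range n (scale_index p).
Proof. by move=> rp i; rewrite ffunE ltn_scale. Qed.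

Lemma in_range_peel p : in_range n p -> in_range peel_dims (peel_index p).
Proof.
move=> rp i; have := rp i; rewrite !ffunE; case: eqP => // -> ltp.
by rewrite ltn_divLR // divnK // dvdn_axis_size.
Qed.

Lemma peel_scale : cancel scale_index peel_index.
Proof.
move=> p; apply/ffunP => i; rewrite !ffunE /scale eqxx mulnK //.
by case: eqP => [->|].
Qed.

Lemma system_sum_scale p : in_range peel_dims p ->
  system_sum g (scale_index p) = system_sum peel_axes p * f.
Proof.
move=> rp; rewrite /system_sum big_distrl /=; apply: eq_bigr => i _.
by rewrite ffunE divnK // dvdn_scaled_axis.
Qed.

Lemma system_sum_peel p : in_range n p ->
  system_sum g p = p j %% f + f * system_sum peel_axes (peel_index p).
Proof.
move=> rp; rewrite mulnC -system_sum_scale; last exact: in_range_peel.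
have -> : scale_index (peel_index p) = update p j (p j %/ f * f).
  by apply/ffunP => i; rewrite !ffunE /scale; case: eqP.
rewrite system_sum_update (system_sumD1 g p j) addnA; congr (_ + _).
have ltq : p j %/ f * f < n j by exact: leq_ltn_trans (leq_divM _ _) (rp j).
by rewrite {1}(divn_eq (p j) f) (axis_block ltq (ltn_pmod _ f_gt0)) addnC.
Qed.

Lemma sum_system_peel : sum_system peel_dims peel_axes.
Proof.
split=> [i|i|i a b lta ltb ltab|p p' rp rp' pp'|p x rp lex].
- rewrite ffunE; case: eqP => _; last exact: system_gt0 sys i.
  by rewrite divn_gt0 // dvdn_leq ?dvdn_axis_size ?(system_gt0 sys).
- by rewrite /peel_axes /scale mul0n if_same (system_axis0 sys) div0n.
- rewrite ltn_divLR // divnK ?dvdn_scaled_axis //.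
  apply: (system_mono sys); rewrite ?inE ?ltn_scale //.
  by rewrite /scale; case: eqP; rewrite ?ltn_pmul2r.
- apply/(can_inj peel_scale)/(system_inj sys).
  + exact: in_range_scale.
  + exact: in_range_scale.
  + by rewrite !system_sum_scale // pp'.
- have lexf : x * f <= system_sum g (scale_index p).
    by rewrite system_sum_scale // leq_mul2r lex orbT.
  have [p' rp' xE] := system_down sys (in_range_scale rp) lexf.
  exists (peel_index p'); first exact: in_range_peel.
  have := ltn_pmod (p' j) f_gt0; move: xE; rewrite (system_sum_peel rp').
  move: (system_sum _ _) (p' j %% f) => y r; nia.
Qed.

Lemma one_notin_peel_axis : 1 \notin axis peel_dims peel_axes j.
Proof.
apply/negP => /mem_mkseqP[t ltt gt1]; case: gap.2; apply/mem_mkseqP.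
exists (scale j t); first exact: ltn_scale.
by rewrite -(divnK (dvdn_scaled_axis ltt)) [_ %/ f]gt1 mul1n.
Qed.

Lemma ltn_sum_peel_dims : 1 < f -> \sum_i peel_dims i < \sum_i n i.
Proof.
move=> f_gt1; rewrite (bigD1 j) //= [X in _ < X](bigD1 j) //= update_same.
rewrite (eq_bigr n) ?ltn_add2r ?ltn_Pdiv ?(system_gt0 sys) //.
by move=> i /negPf ij; rewrite ffunE ij.
Qed.

End Peel.
End SystemTheory.

(* The value at [p] of the composition of the building operators of [s], where
   the head of [s] is applied first. *)
Fixpoint build_value s p : nat :=
  if s is (j, f) :: s' then
    p j %% f + f * build_value s' (update p j (p j %/ f))
  else 0.

Definition build_dims s : {ffun I -> nat} :=
  [ffun i => \prod_(x <- s | x.1 == i) x.2].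

Lemma build_dims_cons j f s :
  build_dims ((j, f) :: s) = update (build_dims s) j (f * build_dims s j).
Proof.
apply/ffunP => i; rewrite !ffunE big_cons /= eq_sym; case: eqP => [->|//].
by congr (_ * _).
Qed.

Lemma prod_build_dims s : \prod_i build_dims s i = \prod_(x <- s) x.2.
Proof.
under eq_bigr do rewrite ffunE.
rewrite (exchange_big_dep xpredT) //=; apply: eq_bigr => x _.
by rewrite (big_pred1 x.1) // => i; rewrite eq_sym.
Qed.

Lemma build_value_modn s p :
  build_value s [ffun i => p i %% build_dims s i] = build_value s p.
Proof.
elim: s p => //= -[j f] s IH p; rewrite build_dims_cons !ffunE eqxx.
rewrite modn_dvdm ?dvdn_mulr //; congr (_ + _ * _); rewrite -[RHS]IH.
congr build_value; apply/ffunP => i; rewrite !ffunE.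
by case: eqP => [->|//]; rewrite modn_divl mulnC.
Qed.

Lemma build_value_rcons s j f p :
  build_value (rcons s (j, f)) p =
    (\prod_(x <- s) x.2) * (p j %/ build_dims s j %% f) + build_value s p.
Proof.
elim: s p => [|[i h] s IH] p /=.
  by rewrite ffunE !big_nil divn1 mul1n muln0.
rewrite IH big_cons build_dims_cons !ffunE mulnDr addnCA mulnA.
by case: eqP => // ->; rewrite divnMA.
Qed.

Definition factorization n g s : Prop :=
  [/\ all (fun x => 1 < x.2) s, build_dims s = n &
      forall p, in_range n p -> system_sum g p = build_value s p].

Lemma factorization_peel n g j f s :
    sum_system n g -> first_gap (fun x => x \in axis n g j) f -> 1 < f ->
    factorization (peel_dims n j f) (peel_axes g j f) s ->
  factorization n g ((j, f) :: s).
Proof.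
move=> sys gap f_gt1 [s_gt1 s_dims s_val]; split=> [|| p rp] /=.
- by rewrite f_gt1.
- rewrite build_dims_cons s_dims update_same update_update mulnC divnK.
    exact: update_id.
  exact: (dvdn_axis_size sys gap).
- rewrite (system_sum_peel sys gap rp) s_val //.
  exact: (in_range_peel sys gap rp).
Qed.

(* The claim on the head of [s] rules out equal consecutive directions. *)
Lemma sum_system_factorization n g : sum_system n g ->
  exists s, [/\ factorization n g s, sorted (fun x y => y.1 != x.1) s &
    forall x s', s = x :: s' -> 1 \in axis n g x.1].
Proof.
have [N] := ubnP (\sum_i n i).
elim: N => // N IH in n g * => ltN sys.
have [/forallP n1|] := boolP [forall i, n i == 1].
  exists [::]; split=> //; split=> // [|p rp].
    by apply/ffunP => i; rewrite ffunE big_nil (eqP (n1 i)).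
  rewrite -[RHS](system_sum_zero sys); congr system_sum; apply/ffunP => i.
  by have := rp i; rewrite ffunE (eqP (n1 i)); case: (p i).
rewrite negb_forall => /existsP[i ni].
have ni_gt1 : 1 < n i by have := system_gt0 sys i; lia.
have [j axis1] := exists_one_in_axis sys ni_gt1.
have [f f_gt1 gap] := exists_first_gap sys axis1.
have lt_sum := leq_trans (ltn_sum_peel_dims sys j f_gt1) ltN.
have [s [s_fact s_sorted s_head]] := IH _ _ lt_sum (sum_system_peel sys gap).
exists ((j, f) :: s); split; first exact: factorization_peel.
  case: s s_sorted s_head {s_fact} => //= x s -> s_head; rewrite andbT.
  by apply: contraTneq (s_head x s erefl) => ->; exact: one_notin_peel_axis.
by move=> x s' [<- _].
Qed.

End SumSystem.

Section IndexTheory.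

Variables (m : nat) (n : dims m).
Implicit Types (k : cindex n) (i j : 'I_m).

Definition index_val k : dims m := [ffun i => k i : nat].

Lemma in_range_index_val k : in_range n (index_val k).
Proof. by move=> i; rewrite ffunE. Qed.

Lemma index_val_onto p : in_range n p -> exists k, index_val k = p.
Proof.
move=> rp; exists [ffun i => Ordinal (rp i)].
by apply/ffunP => i; rewrite !ffunE.
Qed.

Lemma set_coord_same k j (a : 'I_(n j)) : set_coord k a j = a.
Proof. by rewrite ffunE dfwith_in. Qed.

Lemma set_coord_other k i j (a : 'I_(n j)) : i != j -> set_coord k a i = k i.
Proof. by move=> ij; rewrite ffunE dfwith_out // eq_sym. Qed.

Lemma set_coord_id k j : set_coord k (k j) = k.
Proof.
apply/ffunP => i; have [->|ij] := eqVneq i j; first exact: set_coord_same.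
exact: set_coord_other.
Qed.

Lemma set_coord_set k j (a b : 'I_(n j)) :
  set_coord (set_coord k a) b = set_coord k b.
Proof.
apply/ffunP => i; have [->|ij] := eqVneq i j; first by rewrite !set_coord_same.
by rewrite !set_coord_other.
Qed.

Lemma set_coordC k i j (a : 'I_(n i)) (b : 'I_(n j)) : i != j ->
  set_coord (set_coord k a) b = set_coord (set_coord k b) a.
Proof.
move=> ij; apply/ffunP => l; have [->|lj] := eqVneq l j.
  by rewrite set_coord_same set_coord_other 1?eq_sym // set_coord_same.
rewrite set_coord_other //; have [->|li] := eqVneq l i.
  by rewrite !set_coord_same.
by rewrite !set_coord_other.
Qed.

Lemma cindex_ind (k0 : cindex n) (P : cindex n -> Prop) :
    P k0 -> (forall k j (a : 'I_(n j)), P k -> P (set_coord k a)) ->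
  forall k, P k.
Proof.
move=> P0 Pset k; pose mix s := foldl (fun k' i => set_coord k' (k i)) k0 s.
suff mixE s i : mix s i = if i \in s then k i else k0 i.
  have <- : mix (enum 'I_m) = k by apply/ffunP => i; rewrite mixE mem_enum.
  by elim/last_ind: (enum _) => // s j; rewrite /mix foldl_rcons; exact: Pset.
elim/last_ind: s => // s j IH; rewrite /mix foldl_rcons mem_rcons inE.
by have [->|ij] := eqVneq i j; rewrite ?set_coord_same ?set_coord_other.
Qed.

End IndexTheory.

Section PropertyV.

Variables (m : nat) (n : dims m) (M : cuboid n).
Hypothesis MV : propertyV M.

Lemma propertyV_neq i j k (a : 'I_(n i)) (b : 'I_(n j)) : i != j ->
  M k + M (set_coord (set_coord k a) b) = M (set_coord k a) + M (set_coord k b).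
Proof.
move=> ij; case: (ltngtP i j) => [ltij|gtij|/val_inj ijE].
- by rewrite (MV ltij) addnC.
- by rewrite set_coordC // (MV gtij).
- by rewrite ijE eqxx in ij.
Qed.

Lemma propertyV_exchange k k' j (a b : 'I_(n j)) :
  M (set_coord k a) + M (set_coord k' b) =
  M (set_coord k b) + M (set_coord k' a).
Proof.
elim/(@cindex_ind _ _ k'): k => [|k i c IH]; first exact: addnC.
have [ij|ij] := eqVneq i j; first by subst i; rewrite !set_coord_set.
have := propertyV_neq k c a ij; have := propertyV_neq k c b ij; lia.
Qed.

(* [M k - M k0 = \sum_i (M (set_coord k0 (k i)) - M k0)], stated without
   truncated subtraction. *)
Lemma propertyV_sum k0 k :
  M k + \sum_(i < m) M k0 = M k0 + \sum_(i < m) M (set_coord k0 (k i)).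
Proof.
elim/(@cindex_ind _ _ k0): k => [|k j a IH].
  by congr (_ + _); apply: eq_bigr => i _; rewrite set_coord_id.
have restE : \sum_(i < m | i != j) M (set_coord k0 (set_coord k a i)) =
             \sum_(i < m | i != j) M (set_coord k0 (k i)).
  by apply: eq_bigr => i ij; rewrite set_coord_other.
have := propertyV_exchange k k0 a (k j); rewrite set_coord_id.
move: IH; rewrite !(bigD1 (P := xpredT) j) //= set_coord_same restE.
move: (\sum_(i < m | _) M k0) (\sum_(i < m | _) _) => origin_sum axis_sum; lia.
Qed.

End PropertyV.

Section PrincipalReversible.

Variables (m : nat) (n : dims m) (M : cuboid n).
Hypothesis n_gt0 : forall i, 0 < n i.
Hypothesis M_rev : principal_reversible M.
Implicit Types (k : cindex n) (i : 'I_m).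

Let k0 : cindex n := [ffun i => Ordinal (n_gt0 i)].

(* For [a] out of range this is the junk value at the origin. *)
Definition axis_value i a : nat :=
  M (set_coord k0 (insubd (Ordinal (n_gt0 i)) a)).

Lemma axis_valueE i (a : 'I_(n i)) : axis_value i a = M (set_coord k0 a).
Proof. by rewrite /axis_value valKd. Qed.

Lemma set_coord0 i : set_coord k0 (Ordinal (n_gt0 i)) = k0.
Proof. by rewrite -[RHS](set_coord_id k0 i) ffunE. Qed.

Lemma cuboid_origin_min i (a : 'I_(n i)) : M k0 <= M (set_coord k0 a).
Proof.
have [_ _ M_mono] := M_rev; have [a0|a_gt0] := posnP a.
  by have -> : a = Ordinal (n_gt0 i); [exact: val_inj | rewrite set_coord0].
by apply/ltnW/M_mono; rewrite ffunE.
Qed.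

Lemma cuboid_origin : M k0 = 0.
Proof.
have [MV M_im _] := M_rev.
have /M_im[k Mk] : 0 < \prod_i n i by rewrite prodn_gt0.
have le_sum : \sum_(i < m) M k0 <= \sum_(i < m) M (set_coord k0 (k i)).
  by apply: leq_sum => i _; exact: cuboid_origin_min.
move: le_sum; rewrite -(leq_add2l (M k0)) -(propertyV_sum MV) Mk.
by rewrite leq_add2r leqn0 => /eqP.
Qed.

Lemma cuboid_sum k : M k = system_sum axis_value (index_val k).
Proof.
have [MV _ _] := M_rev; have := propertyV_sum MV k0 k.
rewrite cuboid_origin big1 // addn0 add0n => ->.
by apply: eq_bigr => i _; rewrite ffunE axis_valueE.
Qed.

Lemma cuboid_inj : injective M.
Proof.
have [_ M_im _] := M_rev.
have ltM k : M k < \prod_i n i by apply/M_im; exists k.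
pose F k := Ordinal (ltM k).
suff F_inj : injective F by move=> k k' kk'; apply/F_inj/val_inj.
have card_index : #|{: cindex n}| = #|'I_(\prod_i n i)|.
  rewrite card_ord card_dep_ffun foldrE big_image /=.
  by apply: eq_bigr => i _; rewrite card_ord.
suff /image_injP F_inj : #|image F predT| == #|{: cindex n}|.
  by move=> k k' kk'; apply: F_inj.
rewrite card_index; apply/eqP/eq_card => x; rewrite inE; apply/imageP.
by have /M_im[k kx] := ltn_ord x; exists k => //; exact: val_inj.
Qed.

Lemma axis_value_mono i : {in gtn (n i) &, {homo axis_value i : a b / a < b}}.
Proof.
have [_ _ M_mono] := M_rev; move=> a b lta ltb ltab.
rewrite (axis_valueE (Ordinal lta)) (axis_valueE (Ordinal ltb)).
rewrite -(set_coord_set k0 (Ordinal lta) (Ordinal ltb)).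
by apply: M_mono; rewrite set_coord_same.
Qed.

Lemma cuboid_sum_system : sum_system n axis_value.
Proof.
have [_ M_im _] := M_rev; split=> //.
- move=> i; rewrite (axis_valueE (Ordinal (n_gt0 i))) set_coord0.
  exact: cuboid_origin.
- exact: axis_value_mono.
- move=> _ _ /index_val_onto[k <-] /index_val_onto[k' <-].
  by rewrite -!cuboid_sum => /cuboid_inj ->.
- move=> _ x /index_val_onto[k <-]; rewrite -cuboid_sum => lex.
  have /M_im[k' <-] : x < \prod_i n i.
    by apply: leq_ltn_trans lex _; apply/M_im; exists k.
  by exists (index_val k'); [exact: in_range_index_val | rewrite cuboid_sum].
Qed.

End PrincipalReversible.

Section BuildingComposition.

Variable m : nat.
Implicit Types (n : dims m) (s : seq ('I_m * nat)).

Lemma eq_pack n n' (M : cuboid n) (M' : cuboid n') : n = n' ->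
    (forall k k', index_val k = index_val k' -> M k = M' k') ->
  pack M = pack M'.
Proof.
move=> nn'; subst n' => MM'; congr pack; apply/ffunP => k; exact: MM'.
Qed.

Lemma kron_dims_divn n j f (p : cindex (kron_dims n j f)) : p j %/ n j < f.
Proof.
have := ltn_ord (p j); rewrite {2}ffunE eqxx; case: (n j) => [|d] ltp.
  by rewrite muln0 in ltp.
by rewrite ltn_divLR.
Qed.

Lemma buildingE n (M : cuboid n) j f (p : cindex (kron_dims n j f)) :
  building j f M p = (\prod_i n i) * (p j %/ n j) + M (kron_index p).
Proof.
have ltf := kron_dims_divn p.
rewrite [LHS]ffunE [kron _ (iota_tuple f 0) _ _]ffunE [kron _ _ M _]ffunE /=.
by rewrite nth_iota // nth_nseq ltf [[ffun=> 1] _]ffunE muln1 mul1n.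
Qed.

Lemma build_dims_rcons s j f :
  build_dims (rcons s (j, f)) = kron_dims (build_dims s) j f.
Proof.
apply/ffunP => i; rewrite !ffunE big_rcons /= eq_sym.
by case: eqP => [->|_]; rewrite ?muln1 // mulnC.
Qed.

Definition build_cuboid s : cuboid (build_dims s) :=
  [ffun k => build_value s (index_val k)].

Lemma building_build_cuboid s j f :
  pack (building j f (build_cuboid s)) = pack (build_cuboid (rcons s (j, f))).
Proof.
apply: eq_pack => [|p k pk]; first by rewrite build_dims_rcons.
have pj : p j %/ build_dims s j %% f = p j %/ build_dims s j.
  by rewrite modn_small ?kron_dims_divn.
rewrite buildingE prod_build_dims [build_cuboid s _]ffunE [RHS]ffunE -pk.
rewrite build_value_rcons [index_val p j]ffunE pj -[in RHS]build_value_modn.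
congr (_ + build_value _ _); apply/ffunP => i.
by rewrite [LHS]ffunE [kron_index _ _]ffunE [RHS]ffunE [index_val p i]ffunE.
Qed.

Lemma foldl_packed_building s :
  foldl (@packed_building m) (pack (trivial_cuboid m)) s =
  pack (build_cuboid s).
Proof.
elim/last_ind: s => [|s [j f] IH].
  apply: eq_pack => [|k k' _]; last by rewrite !ffunE.
  by apply/ffunP => i; rewrite !ffunE big_nil.
by rewrite foldl_rcons IH; exact: building_build_cuboid.
Qed.

Lemma building_comp_tnth s (C : packed_cuboid m) :
  building_comp (fun l => (tnth (in_tuple s) l).1)
    (fun l => (tnth (in_tuple s) l).2) C = foldl (@packed_building m) C s.
Proof.
rewrite /building_comp; congr foldl; rewrite -[RHS](map_tnth_enum (in_tuple s)).
by apply: eq_map => l; rewrite -surjective_pairing.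
Qed.

Lemma build_dims_tnth s i :
  \prod_(l < size s | (tnth (in_tuple s) l).1 == i) (tnth (in_tuple s) l).2 =
  build_dims s i.
Proof. by rewrite ffunE (big_tnth _ _ s); exact: eq_bigl. Qed.

End BuildingComposition.

Theorem theorem8 (m : nat) (n : dims m) (M : cuboid n)
    (hm : 0 < m) (hn : forall j : 'I_m, 0 < n j)
    (hM : principal_reversible M) :
  exists (L : nat) (j : 'I_L -> 'I_m) (f : 'I_L -> nat),
    [/\ forall l : 'I_L, 2 <= f l,
        forall i : 'I_m, \prod_(l < L | j l == i) f l = n i,
        pack M = building_comp j f (pack (trivial_cuboid m)) &
        forall l l' : 'I_L, l' = l.+1 :> nat -> j l' <> j l].
Proof.
have [s [[s_gt1 s_dims s_val] s_sorted _]] :=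
  sum_system_factorization (cuboid_sum_system hn hM).
pose t := tnth (in_tuple s).
exists (size s), (fun l => (t l).1), (fun l => (t l).2); split.
- by move=> l; apply: (allP s_gt1); exact: mem_tnth.
- by move=> i; rewrite build_dims_tnth s_dims.
- rewrite building_comp_tnth foldl_packed_building.
  apply: eq_pack => // k k' kk'; rewrite (cuboid_sum hn hM) ffunE -kk' s_val //.
  exact: in_range_index_val.
- move=> l l' l'l; apply/eqP; have := ltn_ord l'; rewrite l'l => lt_l.
  have := sortedP (t l) s_sorted l lt_l.
  by rewrite -l'l -!(tnth_nth _ (in_tuple s)).
Qed.
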